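(* Out of all rooted ordered binary trees $T$ of size $k$, the trees for which $\mathbb{P}(\mathrm{DTCS}(k)=T)$ is maximal are the orderings of $\mathrm{CBT}(k)$. Moreover, $$\mathbb{P}(\mathrm{DTCS}(k)=\mathrm{CBT}(k))=2^{-(\alpha+o(1))k}\qquad\text{as }k\to\infty,$$ where $$\alpha=1+\sum_{i=1}^\infty\frac{\log_2 h_{2^i-1}}{2^i}=1.637\ldots$$
   Context: Binary trees are rooted full binary trees: every internal vertex has exactly two children. The size of a tree is its number of leaves. Ordered trees (plane trees) are trees in which the left and right subtrees of each internal vertex are distinguished; $T=T'$ means identical as rooted ordered trees, and $T\cong T'$ means identical as rooted unordered trees. An ordering of a rooted binary tree $T$ is any rooted ordered tree $T'$ with $T'\cong T$. For $m\ge 2$ let $h_{m-1}=\sum_{j=1}^{m-1}1/j$ and let $q_m$ be the probability distribution on $\{1,\dots,m-1\}$ given by $$q_m(i)=\frac{m}{2h_{m-1}}\,\frac{1}{i(m-i)}.$$ The discrete-time critical beta-splitting tree $\mathrm{DTCS}(n)$ is the random rooted ordered binary tree with $n$ leaves built as follows: split $[n]=\{1,\dots,n\}$ into a left subtree on $\{1,\dots,L_n\}$ and a right subtree on $\{L_n+1,\dots,n\}$, where $L_n$ has distribution $q_n$; then recursively and independently split each interval of size $m\ge2$ into left and right parts according to $q_m$, stopping at intervals of size $m=1$ (the leaves). Leaf labels are disregarded when comparing shapes. $\mathrm{CBT}(k)$ is the complete binary tree with $k$ leaves: every level is completely full except possibly the last, which is filled from the left. $\log_2$ is the base-two logarithm.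 *)

(* Defs.v *)
From HB Require Import structures.
From mathcomp Require Import all_boot all_order all_algebra.
From mathcomp Require Import ring zify.
From mathcomp Require Import all_classical all_reals all_analysis.

Set Implicit Arguments.
Unset Strict Implicit.
Unset Printing Implicit Defensive.

Import Order.TTheory GRing.Theory Num.Theory.
Import numFieldNormedType.Exports.

Local Open Scope classical_set_scope.
Local Open Scope ring_scope.

(* Ordered (plane) trees: [=] is identity of rooted ordered trees. *)
Inductive tree : Type := Leaf | Node (l r : tree).

Fixpoint tree_size (t : tree) : nat :=
  if t is Node l r then (tree_size l + tree_size r)%N else 1%N.

(* Identity as rooted unordered trees. *)
Inductive tree_iso : tree -> tree -> Prop :=
| iso_leaf : tree_iso Leaf Leaf
| iso_straight l r l' r' :
    tree_iso l l' -> tree_iso r r' -> tree_iso (Node l r) (Node l' r')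
| iso_swap l r l' r' :
    tree_iso l l' -> tree_iso r r' -> tree_iso (Node l r) (Node r' l').

Definition is_ordering_of (t t' : tree) : Prop := tree_iso t' t.

(* All levels above depth [d] are full, and among the [2 ^ d] vertices at depth
   [d] exactly the [e] leftmost ones have two children ([e <= 2 ^ d]). *)
Fixpoint fill (d e : nat) : tree :=
  if d is d'.+1 then Node (fill d' (minn e (2 ^ d'))) (fill d' (e - 2 ^ d'))
  else if (0 < e)%N then Node Leaf Leaf else Leaf.

(* [k] leaves means [d = floor (log2 k)] full levels below the root, and
   [k - 2 ^ d] vertices at depth [d] with two children each. *)
Definition CBT (k : nat) : tree := fill (trunc_log 2 k) (k - 2 ^ trunc_log 2 k).

Lemma tree_size_fill d e : (e <= 2 ^ d)%N -> tree_size (fill d e) = (2 ^ d + e)%N.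
Proof.
elim: d e => [|d IH] e; first by case: e => [|[|e]].
rewrite expnS mul2n -addnn => he /=.
rewrite !IH ?geq_minr //; last by rewrite leq_subLR.
by rewrite addnACA minnE subnK // leq_subr.
Qed.

Lemma tree_size_CBT k : (0 < k)%N -> tree_size (CBT k) = k.
Proof.
move=> k0; have /andP[le_k lt_k] := trunc_log_bounds (ltnSn 1) k0.
rewrite tree_size_fill ?subnKC //.
by rewrite leq_subLR addnn -mul2n -expnS ltnW.
Qed.

Fixpoint tree_encode (t : tree) : GenTree.tree unit :=
  if t is Node l r then GenTree.Node 0 [:: tree_encode l; tree_encode r]
  else GenTree.Leaf tt.

Fixpoint tree_decode (g : GenTree.tree unit) : tree :=
  if g is GenTree.Node _ [:: l; r] then Node (tree_decode l) (tree_decode r)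
  else Leaf.

Lemma tree_encodeK : cancel tree_encode tree_decode.
Proof. by elim=> //= l -> r ->. Qed.

HB.instance Definition _ := Countable.copy tree (can_type tree_encodeK).
HB.instance Definition _ := isPointed.Build tree Leaf.
HB.instance Definition _ := @isMeasurable.Build default_measure_display
  tree discrete_measurable discrete_measurable0
  discrete_measurableC discrete_measurableU.

Definition join_trees (p : tree * tree) : tree := Node p.1 p.2.

Lemma measurable_join_trees : measurable_fun [set: tree * tree] join_trees.
Proof.
move=> _ A _; rewrite setTI; apply: countable_measurable => [[l r]|].
  rewrite (_ : [set (l, r)] = [set l] `*` [set r]); first exact: measurableX.
  by apply/seteqP; split => [_ -> //|[a b] [/= -> ->]].
exact: countableP.
Qed.

HB.instance Definition _ := @isMeasurableFun.Build _ _ (tree * tree)%type tree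
  join_trees measurable_join_trees.

Section DTCS.
Variable R : realType.

Definition harm (n : nat) : R := \sum_(1 <= j < n.+1) j%:R^-1.

(* The probability [q_m i]; only [1 <= i <= m - 1] is meaningful. *)
Definition beta_split (m i : nat) : R :=
  m%:R / (2 * harm m.-1) * (i%:R * (m - i)%:R)^-1.

Lemma harm_ge0 n : 0 <= harm n.
Proof. by apply: sumr_ge0 => j _; rewrite invr_ge0. Qed.

Lemma harm_gt0 n : 0 < harm n.+1.
Proof.
rewrite /harm big_nat_recl //= ltr_pwDl ?invr_gt0 //.
by apply: sumr_ge0 => j _; rewrite invr_ge0.
Qed.

Lemma beta_split_ge0 m i : 0 <= beta_split m i.
Proof.
rewrite /beta_split mulr_ge0 ?divr_ge0 ?invr_ge0 ?mulr_ge0 ?ler0n //; exact: harm_ge0.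
Qed.

Lemma beta_split_sum1 n : \sum_(i < n.+1) beta_split n.+2 i.+1 = 1.
Proof.
rewrite /beta_split -mulr_sumr /=.
have E : \sum_(i < n.+1) (i.+1%:R * (n.+2 - i.+1)%:R)^-1 =
    (2 * harm n.+1) / n.+2%:R :> R.
  have -> : 2 * harm n.+1 =
      \sum_(i < n.+1) (i.+1%:R^-1 + (n.+2 - i.+1)%:R^-1) :> R.
    rewrite big_split /= mulrDl mul1r; congr +%R.
      by rewrite /harm big_add1 /= big_mkord.
    rewrite /harm big_add1 /= big_mkord (reindex_inj rev_ord_inj) /=.
    by apply: eq_bigr => i _; rewrite [in RHS]subSn // ltn_ord.
  rewrite mulr_suml; apply: eq_bigr => i _.
  have hi : (n.+2 = i.+1 + (n.+2 - i.+1))%N.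
    by rewrite subnKC // ltnW // ltnS.
  have i0 : i.+1%:R != 0 :> R by rewrite pnatr_eq0.
  have j0 : (n.+2 - i.+1)%:R != 0 :> R.
    by rewrite pnatr_eq0 subn_eq0 -ltnNge ltnS.
  have -> : n.+2%:R = i.+1%:R + (n.+2 - i.+1)%:R :> R by rewrite -natrD -hi.
  have s0 : i.+1%:R + (n.+2 - i.+1)%:R != 0 :> R by rewrite -natrD -hi.
  move: i0 j0 s0; move: (i.+1%:R : R) ((n.+2 - i.+1)%:R : R) => a b a0 b0 ab0.
  by field; rewrite a0 b0 ab0.
rewrite E -[X in _ * X]invf_div divff // mulf_neq0 ?pnatr_eq0 // invr_neq0 //.
by rewrite gt_eqF // mulr_gt0 // harm_gt0.
Qed.

Definition beta_split_nng m i : {nonneg R} := NngNum (beta_split_ge0 m i).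

(* Law of a tree of size [m = n.+2] whose left size [i.+1] has distribution
   [beta_split m], and whose left and right subtrees are, given that size, independent
   with laws [D i.+1] and [D (m - i.+1)]. *)
Definition split_law (n : nat) (D : nat -> probability tree R) :
    set tree -> \bar R :=
  msum (fun i => mscale (beta_split_nng n.+2 i.+1)
          (distribution (D i.+1 \x D (n.+2 - i.+1)%N)%E join_trees)) n.+1.

HB.instance Definition _ n D := Measure.on (split_law n D).

Lemma split_law_setT n D : split_law n D [set: tree] = 1%E.
Proof.
transitivity (\sum_(i < n.+1) (beta_split n.+2 i.+1)%:E)%E; last by rewrite sumEFin beta_split_sum1.
apply: eq_bigr => i _; rewrite /mscale -[RHS]mule1; congr (_ * _)%E.
exact: probability_setT.
Qed.

HB.instance Definition _ n D :=
  Measure_isProbability.Build _ _ _ (split_law n D) (@split_law_setT n D).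

(* The first argument bounds the recursion depth; [m] suffices for size [m]. *)
Fixpoint dtcs_rec (fuel m : nat) : probability tree R :=
  match fuel, m with
  | f.+1, n.+2 => split_law n (dtcs_rec f)
  | _, _ => \d_Leaf
  end.

(* The law of the random tree; only sizes [k >= 1] are meaningful. *)
Definition DTCS (k : nat) : probability tree R := dtcs_rec k k.

Lemma eq_split_law n (D D' : nat -> probability tree R) A :
  (forall i B, (0 < i <= n.+1)%N -> D i B = D' i B) ->
  split_law n D A = split_law n D' A.
Proof.
move=> DD'; apply: eq_bigr => i _; rewrite /mscale; congr (_ * _)%E.
have hi := ltn_ord i.
rewrite /distribution /pushforward /product_measure1.
transitivity (\int[D i.+1]_x
    (D' (n.+2 - i.+1)%N \o xsection (join_trees @^-1` A)) x)%E.
  by apply: eq_integral => x _ /=; apply: DD'; lia.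
by apply: eq_measure_integral => B _ _; apply: DD'; lia.
Qed.

Lemma dtcs_rec_fuel f g m A : (m <= f)%N -> (m <= g)%N ->
  dtcs_rec f m A = dtcs_rec g m A.
Proof.
elim: f g m A => [|f IH] [|g] [|[|n]] A //= hf hg.
by apply: eq_split_law => i B hi; apply: IH; lia.
Qed.

Lemma DTCS1 A : DTCS 1 A = (\d_Leaf A : \bar R)%E.
Proof. by []. Qed.

Lemma DTCS_split n A : DTCS n.+2 A = split_law n DTCS A.
Proof.
apply: eq_split_law => i B /andP[_ hi].
exact: (dtcs_rec_fuel B hi (leqnn i)).
Qed.

End DTCS.

Definition log2 (R : realType) (x : R) : R := ln x / ln 2.

(* Index shifted by one: the [n]-th entry is the term [i = n + 1]. *)
Definition alpha_term (R : realType) (n : nat) : R :=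
  log2 (harm R (2 ^ n.+1 - 1)%N) / 2 ^+ n.+1.

Definition alpha (R : realType) : R := 1 + limn (series (@alpha_term R)).

(* Main.v *)
(* Each internal vertex of size m contributes m / (2 h_{m-1}) divided by the
   sizes of its children, so the product telescopes:
     P(DTCS(k) = T) = k 2^{1-k} prod_v 1 / h_{m_v - 1} = k 2^{1 - k - c(T)},
   where c(T) is the sum of log2 h_{m_v - 1} over the internal vertices v.

   Maximality is minimality of c.  The weight m |-> log2 h_{m-1} is strictly
   increasing and strictly concave.  By induction on n, the root split (a, b) of
   a tree of size n minimising c, with a >= b, is that of CBT(n).  Otherwise, with
   CBT splits a = a1 + a2 and b = b1 + b2, one of two moves improves: split
   ai + b again as CBT and join its smaller part to the other half of a, which
   shrinks a vertex (monotonicity); or split a2 + b1 again as CBT, join its larger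
   part to a1 and its smaller part to b2, which spreads the sizes of two sibling
   vertices apart (concavity).

   For the asymptotics, c(CBT(2^d)) is 2^d times the d-th partial sum of the series
   of alpha, whose tail is at most (d + 2) / 2^d; descending along the one
   non-full subtree of CBT(k) at each level yields
   c(CBT(k)) = (alpha - 1) k + O(log^2 k).

   The lower bound 1.637 is off by about 1.5e-6 only.  Twice the partial
   sums of the series are log2 (x_0 sqrt (x_1 sqrt (x_2 ...))) with
   x_i = h_{2^{i+1} - 1}; this nested radical is evaluated with rounding in
   fixed-point arithmetic. *)

From Stdlib Require Import NArith.
Require Import Defs.
From mathcomp Require Import all_boot all_order all_algebra.
From mathcomp Require Import ring lra zify.
From mathcomp Require Import all_classical all_reals all_analysis.

Import Order.TTheory GRing.Theory Num.Theory.
Import numFieldNormedType.Exports.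

Local Open Scope classical_set_scope.
Local Open Scope ring_scope.

(** * Trees of minimal cost *)

Lemma tree_size_gt0 T : (0 < tree_size T)%N.
Proof. by elim: T => //= l hl r hr; rewrite addn_gt0 hl. Qed.

(** A power of two has two descriptions, a full last level or an empty next one; this lets
    [CBT_fill] include [e = 2 ^ d]. *)
Lemma fill_full d : fill d (2 ^ d) = fill d.+1 0.
Proof.
elim: d => [//|d IH].
have -> : fill d.+2 0 = Node (fill d.+1 0) (fill d.+1 0) by rewrite /= min0n sub0n.
by rewrite -IH /= expnS mul2n -addnn addnK (minn_idPr (leq_addr _ _)).
Qed.

Lemma CBT_fill d e : (e <= 2 ^ d)%N -> CBT (2 ^ d + e) = fill d e.
Proof.
rewrite leq_eqVlt => /predU1P[->|lt_e].
  by rewrite addnn -mul2n -expnS /CBT trunc_expnK // subnn fill_full.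
rewrite /CBT (@trunc_log_eq 2 d (2 ^ d + e)) ?addKn //.
by rewrite leq_addr expnS mul2n -addnn ltn_add2l.
Qed.

(* [(x, y)] are the sizes of the left and right subtrees of [CBT (x + y)]. *)
Definition cbt_split (x y : nat) : Prop :=
  exists d, y = (2 ^ d)%N /\ (2 ^ d <= x <= 2 ^ d.+1)%N \/
            x = (2 ^ d.+1)%N /\ (2 ^ d <= y <= 2 ^ d.+1)%N.

Lemma cbt_split_CBT x y :
  cbt_split x y -> CBT (x + y) = Node (CBT x) (CBT y).
Proof.
have E d e : (e <= 2 ^ d.+1)%N -> CBT (2 ^ d.+1 + e) =
    Node (CBT (2 ^ d + minn e (2 ^ d))) (CBT (2 ^ d + (e - 2 ^ d))).
  move=> le_e; rewrite CBT_fill // !CBT_fill ?geq_minr //.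
  by rewrite leq_subLR addnn -mul2n -expnS.
move=> [d [[-> hx]|[-> hy]]].
  have -> : (x + 2 ^ d = 2 ^ d.+1 + (x - 2 ^ d))%N.
    by move: hx; rewrite expnS; lia.
  rewrite E; last by move: hx; rewrite expnS; lia.
  by congr (Node (CBT _) (CBT _)); move: hx; rewrite expnS; lia.
rewrite E; last by case/andP: hy.
by congr (Node (CBT _) (CBT _)); move: hy; rewrite expnS; lia.
Qed.

Lemma cbt_split_gt0 x y : cbt_split x y -> (0 < y <= x)%N.
Proof.
by move=> [d]; have := expn_gt0 2 d; rewrite expnS; lia.
Qed.

(** Both pairs are the subtree sizes of one tree, [CBT (x + y)]. *)
Lemma cbt_split_uniq x y x' y' : cbt_split x y -> cbt_split x' y' ->
  (x + y = x' + y')%N -> x = x'.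
Proof.
move=> h h' e; have := cbt_split_CBT _ _ h.
rewrite e (cbt_split_CBT _ _ h') => -[/(congr1 tree_size) + _].
have /andP[y0 yx] := cbt_split_gt0 _ _ h.
have /andP[y0' yx'] := cbt_split_gt0 _ _ h'.
by rewrite !tree_size_CBT //; lia.
Qed.

Lemma exists_cbt_split n : (1 < n)%N -> exists x y, cbt_split x y /\ (x + y = n)%N.
Proof.
move=> n1; have /andP[] := trunc_log_bounds (ltnSn 1) (ltnW n1).
have : (0 < trunc_log 2 n)%N by rewrite trunc_log_gt0.
case: (trunc_log 2 n) => // d _; set D := (2 ^ d)%N => lo hi.
(* Here [2 D <= n < 4 D]; the last level reaches the right subtree only beyond [3 D]. *)
have [h|h] := leqP n (3 * D).
  exists (n - D)%N, D; split; last by move: lo; rewrite expnS; lia.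
  by exists d; left; split=> //; move: lo; rewrite expnS -/D; lia.
exists (2 ^ d.+1)%N, (n - 2 ^ d.+1)%N; split; last by lia.
by exists d; right; split=> //; move: lo hi; rewrite !expnS -/D; lia.
Qed.

Section Cost.
Variables (R : realDomainType) (f : nat -> R).

Fixpoint cost (T : tree) : R :=
  if T is Node l r then f (tree_size T) + cost l + cost r else 0.

Lemma tree_iso_size T T' : tree_iso T T' -> tree_size T = tree_size T'.
Proof. by elim=> //= l r l' r' _ -> _ ->; lia. Qed.

Lemma tree_iso_cost T T' : tree_iso T T' -> cost T = cost T'.
Proof.
elim=> //= l r l' r' /tree_iso_size <- -> /tree_iso_size <- -> //.
by rewrite [(tree_size r + _)%N]addnC addrAC.
Qed.

Lemma cost_split x y : cbt_split x y ->
  cost (CBT (x + y)) = f (x + y) + cost (CBT x) + cost (CBT y).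
Proof.
move=> h; have /andP[y0 yx] := cbt_split_gt0 _ _ h.
by rewrite cbt_split_CBT //= !tree_size_CBT //; lia.
Qed.

Hypothesis f_incr : forall m n, (1 < m < n)%N -> f m < f n.
Hypothesis f_conc : forall a b t, (1 < b < a)%N -> (0 < t)%N ->
  f (a + t) + f b < f a + f (b + t).

Let F n := cost (CBT n).

(** Induction hypothesis of [cbt_split_best]. Root splits are compared with both subtrees complete,
    so only sizes matter. *)
Definition best_below (n : nat) : Prop := forall m x y a b,
  (m < n)%N -> cbt_split x y -> (x + y = m)%N -> (0 < a)%N -> (0 < b)%N ->
  (a + b = m)%N -> F x + F y <= F a + F b.

Lemma cost_le_split n a b : best_below n -> (0 < a)%N -> (0 < b)%N ->
  (a + b < n)%N -> F (a + b) <= f (a + b) + F a + F b.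
Proof.
move=> IH a0 b0 abn.
have [|x [y [h e]]] := exists_cbt_split (a + b); first by lia.
rewrite /F -{1}e cost_split // e -!addrA lerD2l.
exact: (IH (a + b)%N).
Qed.

(* Re-splitting [a1 + b] as [x + y] and joining the smaller part [y] to [a2]
   shrinks the vertex of size [a1 + a2]. *)
Lemma rotation_improves n a1 a2 b x y : best_below n ->
  (0 < a1)%N -> (0 < a2)%N -> (0 < b)%N -> (a1 + a2 + b = n)%N ->
  F (a1 + a2) = f (a1 + a2) + F a1 + F a2 ->
  cbt_split x y -> (x + y = a1 + b)%N -> (y < a1)%N ->
  F (a2 + y) + F x < F (a1 + a2) + F b.
Proof.
move=> IH a10 a20 b0 en Fa h e lt_y; have h0 := cbt_split_gt0 _ _ h.
have : F (a2 + y) <= f (a2 + y) + F a2 + F y by apply: (cost_le_split n) => //; lia.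
have : F x + F y <= F a1 + F b by apply: (IH (a1 + b)%N) => //; lia.
have : f (a2 + y) < f (a1 + a2) by apply: f_incr; lia.
rewrite Fa; lra.
Qed.

(* Re-splitting [a2 + b1] as [x + y] and joining [x] to [a1], [y] to [b2] spreads
   the sizes of the two siblings apart. *)
Lemma exchange_improves n a1 a2 b1 b2 x y : best_below n ->
  (0 < a1)%N -> (0 < a2)%N -> (0 < b1)%N -> (0 < b2)%N ->
  (a1 + a2 + (b1 + b2) = n)%N -> (b1 + b2 <= a1 + a2)%N ->
  F (a1 + a2) = f (a1 + a2) + F a1 + F a2 ->
  F (b1 + b2) = f (b1 + b2) + F b1 + F b2 ->
  cbt_split x y -> (x + y = a2 + b1)%N -> (a2 < x)%N ->
  F (a1 + x) + F (b2 + y) < F (a1 + a2) + F (b1 + b2).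
Proof.
move=> IH a10 a20 b10 b20 en le_ba Fa Fb h e lt_x.
have h0 := cbt_split_gt0 _ _ h.
have : F (a1 + x) <= f (a1 + x) + F a1 + F x by apply: (cost_le_split n) => //; lia.
have : F (b2 + y) <= f (b2 + y) + F b2 + F y by apply: (cost_le_split n) => //; lia.
have : F x + F y <= F a2 + F b1 by apply: (IH (a2 + b1)%N) => //; lia.
have := f_conc (a1 + a2) (b2 + y) (x - a2).
rewrite (_ : a1 + a2 + (x - a2) = a1 + x)%N; last by lia.
rewrite (_ : b2 + y + (x - a2) = b1 + b2)%N; last by lia.
rewrite Fa Fb => fc; have : f (a1 + x) + f (b2 + y) < f (a1 + a2) + f (b1 + b2).
  by apply: fc; lia.
lra.
Qed.

Definition improvable (n a b : nat) : Prop := exists a' b',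
  [/\ (0 < a')%N, (0 < b')%N, (a' + b' = n)%N & F a' + F b' < F a + F b].

(** With [(u, v)] the CBT split of [a], [M1] is the rotation, which needs its smaller new part below
    [u], and [M3] the exchange, which needs its larger new part above [v]. The rest shows that one
    of them applies outside the CBT splits. *)
Lemma improve_or_cbt_split n a b : best_below n -> (0 < b <= a)%N ->
  (a + b = n)%N -> cbt_split a b \/
  improvable n a b.
Proof.
move=> IH /andP[b0 ba] en.
have [a1|a1] := leqP a 1.
  by left; exists 0%N; left; rewrite expn0 expn1; lia.
have [u [v [h e]]] := exists_cbt_split a a1.
have Fa : F (u + v) = f (u + v) + F u + F v by exact: cost_split.
have /andP[v0 vu] := cbt_split_gt0 _ _ h.
have M1 x y : cbt_split x y -> (x + y = u + b)%N -> (y < u)%N -> improvable n a b.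
  move=> hxy exy yu; have h0 := cbt_split_gt0 _ _ hxy.
  exists (v + y)%N, x; split; [lia|lia|lia|].
  by rewrite -e; apply: (rotation_improves n) => //; lia.
(* [x + y = u + b < 2 u] and [y <= x] force [y < u]. *)
have small_b : (b < u)%N -> improvable n a b.
  move=> bu; have [|x [y [hxy exy]]] := exists_cbt_split (u + b); first by lia.
  by apply: (M1 x y) => //; have := cbt_split_gt0 _ _ hxy; lia.
have M3 b1 b2 x y : cbt_split b1 b2 -> (b1 + b2 = b)%N -> cbt_split x y ->
  (x + y = v + b1)%N -> (v < x)%N -> improvable n a b.
  move=> hb eb hxy exy yu; have h0 := cbt_split_gt0 _ _ hxy.
  have h1 := cbt_split_gt0 _ _ hb.
  exists (u + x)%N, (b2 + y)%N; split; [lia|lia|lia|].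
  have Fb : F (b1 + b2) = f (b1 + b2) + F b1 + F b2 by exact: cost_split.
  by rewrite -e -eb; apply: (exchange_improves n) => //; lia.
(* [x] is at least half of [v + b1 > 2 v]. *)
have big_b b1 b2 : cbt_split b1 b2 -> (b1 + b2 = b)%N -> (v < b1)%N -> improvable n a b.
  move=> hb eb vb1; have [|x [y [hxy exy]]] := exists_cbt_split (v + b1); first by lia.
  by apply: (M3 b1 b2 x y) => //; have := cbt_split_gt0 _ _ hxy; lia.
have [/small_b|ub] := ltnP b u; first by right.
case: (h) => d; have := expn_gt0 2 d; have := expnS 2 d; have := expnS 2 d.+1.
set D := (2 ^ d)%N; set D2 := (2 ^ d.+1)%N; set D4 := (2 ^ d.+2)%N.
move=> eD4 eD2 /= D0 [[ev hu]|[eu hv]].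
  (* Case [v = D], [D <= u <= 2 D], [u <= b]. If [b > 2 D] the exchange applies; if [b < 2 D] the
     rotation does, unless [a = 2 D]. *)
  have [bD|bD] := leqP D2 b.
    have [eb|nb] := eqVneq b D2.
      by left; exists d.+1; left; rewrite -/D2 -/D4; lia.
    right; apply: (big_b (b - D)%N D); [|lia|lia].
    by exists d; left; rewrite -/D -/D2; lia.
  have [ea|na] := eqVneq a D2.
    by left; exists d; right; rewrite -/D -/D2; lia.
  right; have [le|gt] := leqP (u + b) (3 * D).
    apply: (M1 (u + b - D)%N D); [|lia|lia].
    by exists d; left; rewrite -/D -/D2; lia.
  apply: (M1 D2 (u + b - D2)%N); [|lia|lia].
  by exists d; right; rewrite -/D -/D2; lia.
(* Case [u = 2 D], [D <= v <= 2 D], [2 D <= b]. Either [a = 4 D] or [b = 2 D] gives a CBT split;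
   otherwise the exchange applies. For [b < 3 D] the part [b - D] may be at most [v], so the new
   split is given explicitly. *)
have [ev|nv] := eqVneq v D2.
  have [eb|nb] := eqVneq b D2.
    by left; exists d.+1; left; rewrite -/D2 -/D4; lia.
  have [lt_b4|] := ltnP b D4; last first.
    by move=> ?; left; exists d.+1; right; rewrite -/D2 -/D4; lia.
  have [le|gt] := leqP b (3 * D).
    have [ea|na] := eqVneq a D4.
      by left; exists d.+1; right; rewrite -/D2 -/D4; lia.
    lia.
  by left; exists d.+1; right; rewrite -/D2 -/D4; lia.
have [eb|nb] := eqVneq b D2.
  by left; exists d.+1; left; rewrite -/D2 -/D4; lia.
right; have [le|gt] := leqP (3 * D) b.
  have [lt_vD|] := ltnP v D2; last by lia.
  apply: (big_b D2 (b - D2)%N); [|lia|lia].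
  by exists d; right; rewrite -/D -/D2; lia.
have [le|lt] := leqP (v + (b - D)) (3 * D).
  apply: (M3 (b - D)%N D (v + (b - D) - D)%N D); [|lia| |lia|lia].
    by exists d; left; rewrite -/D -/D2; lia.
  by exists d; left; rewrite -/D -/D2; lia.
apply: (M3 (b - D)%N D D2 (v + (b - D) - D2)%N); [|lia| |lia|lia].
  by exists d; left; rewrite -/D -/D2; lia.
by exists d; right; rewrite -/D -/D2; lia.
Qed.

(** A minimiser among the finitely many splits, arranged with its larger part first, cannot be
    improved, so it is a CBT split. *)
Lemma exists_best_split n : best_below n -> (1 < n)%N ->
  exists x y, [/\ cbt_split x y, (x + y = n)%N &
    forall a b, (0 < a)%N -> (0 < b)%N -> (a + b = n)%N ->
      F x + F y <= F a + F b].
Proof.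
case: n => [|[|n]] // IH _.
pose s (i : 'I_n.+1) := F i.+1 + F (n.+2 - i.+1).
have [i0 _ s_min] := @arg_minP _ _ _ (@ord0 n) xpredT s isT.
have best a b : (0 < a)%N -> (0 < b)%N -> (a + b = n.+2)%N -> s i0 <= F a + F b.
  move=> a0 b0 eab; have lt_a : (a.-1 < n.+1)%N by lia.
  have := s_min (Ordinal lt_a) isT; rewrite /s /= prednK //.
  by rewrite (_ : (n.+2 - a = b)%N) //; lia.
have i0n := ltn_ord i0.
pose hi := maxn i0.+1 (n.+2 - i0.+1); pose lo := minn i0.+1 (n.+2 - i0.+1).
have s_hilo : s i0 = F hi + F lo.
  rewrite /s /hi /lo; case: (leqP i0.+1 (n.+2 - i0.+1)) => _ //.
  by rewrite addrC.
have [||h|[a [b [a0 b0 eab lt_ab]]]] := @improve_or_cbt_split n.+2 hi lo IH.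
- by rewrite /hi /lo; lia.
- by rewrite /hi /lo; lia.
- exists hi, lo; split=> //; first by rewrite /hi /lo; lia.
  by rewrite -s_hilo.
by have := best a b a0 b0 eab; rewrite s_hilo; lra.
Qed.

(** [exists_best_split] yields some optimal CBT split; by uniqueness it is the given one. *)
Lemma cbt_split_best n : best_below n.
Proof.
elim: n => [|n IH] // m x y a b; rewrite ltnS leq_eqVlt => /predU1P[->|]; last exact: IH.
move=> h e a0 b0 eab; have h0 := cbt_split_gt0 _ _ h.
have [|x' [y' [h' e' best]]] := exists_best_split n IH; first by lia.
have ex : x = x' by apply: (cbt_split_uniq _ _ _ _ h h'); lia.
have -> : y = y' by lia.
by rewrite ex; exact: best.
Qed.

Lemma cbt_split_best_uniq x y a b : cbt_split x y -> (0 < a)%N -> (0 < b)%N ->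
  (a + b = x + y)%N -> F a + F b <= F x + F y ->
  a = x /\ b = y \/ a = y /\ b = x.
Proof.
move=> h; wlog ba : a b / (b <= a)%N => [W a0 b0 e le_ab|a0 b0 e le_ab].
  have [ba|/ltnW ab] := leqP b a; first exact: W.
  have /W : (a <= b)%N := ab.
  by rewrite addrC addnC => /(_ b0 a0 e le_ab); tauto.
have [||h'|[a' [b' [a0' b0' e' lt_ab]]]] :=
  @improve_or_cbt_split (x + y) a b (cbt_split_best _).
- by lia.
- by [].
- by have := cbt_split_uniq _ _ _ _ h' h e; lia.
have := cbt_split_best _ _ _ _ _ _ (ltnSn (x + y)%N) h erefl a0' b0' e'.
by move=> le_xy; have := le_lt_trans (le_trans le_ab le_xy) lt_ab; rewrite ltxx.
Qed.

Lemma cost_CBT_le T : F (tree_size T) <= cost T.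
Proof.
elim: T => [|l IHl r IHr] //=.
have := tree_size_gt0 l; have := tree_size_gt0 r.
move: (tree_size l) (tree_size r) IHl IHr => a b IHl IHr b0 a0.
have : F (a + b) <= f (a + b) + F a + F b.
  by apply: (cost_le_split (a + b).+1) => //; exact: cbt_split_best.
by lra.
Qed.

(** Equality must hold throughout [cost_CBT_le]: both subtrees have minimal cost and their sizes
    form an optimal split, which is unique up to a swap. *)
Lemma cost_CBT_eq T : cost T <= F (tree_size T) -> tree_iso (CBT (tree_size T)) T.
Proof.
elim: T => [|l IHl r IHr] //=; first by move=> _; constructor.
have sl := tree_size_gt0 l; have sr := tree_size_gt0 r.
have cl := cost_CBT_le l; have cr := cost_CBT_le r.
have [|x [y [h e]]] := exists_cbt_split (tree_size l + tree_size r); first by lia.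
have := cbt_split_best _ _ _ _ _ _ (ltnSn _) h e sl sr erefl.
rewrite -e [F (x + y)]cost_split // => le_xy le_c.
have {}IHl : tree_iso (CBT (tree_size l)) l.
  by apply: IHl; move: le_xy le_c cl cr; rewrite /F; lra.
have {}IHr : tree_iso (CBT (tree_size r)) r.
  by apply: IHr; move: le_xy le_c cl cr; rewrite /F; lra.
rewrite cbt_split_CBT //.
have [||||[ex ey]|[ex ey]] := cbt_split_best_uniq _ _ (tree_size l) (tree_size r) h => //.
- by move: le_xy le_c cl cr; rewrite /F; lra.
- by constructor; rewrite -?ex -?ey.
- by constructor; rewrite -?ex -?ey.
Qed.

Lemma cost_minimal_iff T : (forall T', tree_size T' = tree_size T -> cost T <= cost T') <->
  is_ordering_of T (CBT (tree_size T)).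
Proof.
split=> [T_min|iso T' eT'].
  by apply: cost_CBT_eq; apply: T_min; rewrite tree_size_CBT ?tree_size_gt0.
by rewrite -(tree_iso_cost _ _ iso) -eT'; exact: cost_CBT_le.
Qed.
End Cost.

(** * The law of the random tree *)

Lemma DTCS_preimage (R : realType) n (A : set tree) : DTCS R n.+2 A =
  (\sum_(i < n.+1) (beta_split R n.+2 i.+1)%:E *
     (DTCS R i.+1 \x DTCS R (n.+2 - i.+1)) (join_trees @^-1` A))%E.
Proof. by rewrite DTCS_split. Qed.

Lemma DTCS_leafS (R : realType) n : DTCS R n.+2 [set Leaf] = 0%E.
Proof.
rewrite DTCS_preimage; apply: big1 => i _.
rewrite (_ : join_trees @^-1` _ = set0) ?measure0 ?mule0 //.
by apply/seteqP; split => // -[].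
Qed.

Lemma DTCS_node (R : realType) n l r : DTCS R n.+2 [set Node l r] =
  (\sum_(i < n.+1) (beta_split R n.+2 i.+1)%:E *
     (DTCS R i.+1 [set l] * DTCS R (n.+2 - i.+1) [set r]))%E.
Proof.
rewrite DTCS_preimage; apply: eq_bigr => i _.
rewrite (_ : join_trees @^-1` _ = [set l] `*` [set r]) ?product_measure1E //.
by apply/seteqP; split=> [[a b] [-> ->]|[a b] [/= -> ->]].
Qed.

(** Leaves only the term of left size [tree_size l] in the sum of [DTCS_node]. *)
Lemma DTCS_size (R : realType) k T : (0 < k)%N -> tree_size T != k ->
  DTCS R k [set T] = 0%E.
Proof.
elim: T k => [|l IHl r IHr] [|[|n]] // _ eT; first exact: DTCS_leafS.
  by rewrite DTCS1 diracE memNset.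
rewrite DTCS_node big1 // => i _; have hi := ltn_ord i.
have [el|nl] := eqVneq (tree_size l) i.+1; last by rewrite IHl // mul0e mule0.
rewrite IHr ?mule0 //; first by lia.
by apply: contra eT => /eqP er; rewrite /= el er; apply/eqP; lia.
Qed.

Lemma harm_pos (R : realType) n : (0 < n)%N -> 0 < harm R n.
Proof. by case: n => // n _; exact: harm_gt0. Qed.

Lemma powR2_log2 (R : realType) (x : R) : 0 < x -> 2 `^ (log2 x) = x.
Proof.
move=> x0; rewrite /powR pnatr_eq0 /= /log2 divfK ?lnK ?posrE //.
by rewrite gt_eqF // ln_gt0 // ltr1n.
Qed.

Definition split_cost (R : realType) (m : nat) : R := log2 (harm R m.-1).

Lemma DTCS_cost (R : realType) T : DTCS R (tree_size T) [set T] =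
  ((tree_size T)%:R *
    2 `^ (1 - (tree_size T)%:R - cost R (split_cost R) T))%:E.
Proof.
elim: T => [|l IHl r IHr].
  by rewrite DTCS1 diracE mem_set //= subrr subr0 powRr0 mulr1.
have sl := tree_size_gt0 l; have sr := tree_size_gt0 r.
rewrite [tree_size _]/=; case em: (tree_size l + tree_size r)%N => [|[|n]]; [lia|lia|].
rewrite DTCS_node; have lt_l : ((tree_size l).-1 < n.+1)%N by lia.
rewrite (bigD1 (Ordinal lt_l)) //= big1 ?adde0 => [|i /eqP ni]; last first.
  rewrite [DTCS R i.+1 _]DTCS_size ?mul0e ?mule0 //; apply/eqP => eli.
  by apply: ni; apply: val_inj; rewrite /= eli.
rewrite prednK // (_ : (n.+2 - tree_size l)%N = tree_size r); last by lia.
rewrite IHl IHr -!EFinM em; congr _%:E.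
have h0 : 0 < harm R n.+1 := harm_gt0 R n.
rewrite /beta_split /= (_ : (n.+2 - tree_size l)%N = tree_size r); last by lia.
set cl := cost _ _ l; set cr := cost _ _ r.
(* The last summand is the exponent of the factor [1 / (2 h)] of [beta_split]; the sizes of the
   children cancel against its denominator. *)
have -> : 1 - n.+2%:R - (split_cost R n.+2 + cl + cr) =
   (1 - (tree_size l)%:R - cl) + (1 - (tree_size r)%:R - cr) + (- 1 - log2 (harm R n.+1)).
  have -> : n.+2%:R = (tree_size l)%:R + (tree_size r)%:R :> R by rewrite -natrD em.
  by rewrite /split_cost /=; ring.
have two0 : (2 : R) != 0 by rewrite pnatr_eq0.
rewrite !powRD ?two0 ?implybT // !powRN powRr1 ?powR2_log2 //.
have nl : (tree_size l)%:R != 0 :> R by rewrite pnatr_eq0; lia.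
have nr : (tree_size r)%:R != 0 :> R by rewrite pnatr_eq0; lia.
by field; rewrite nl nr (gt_eqF h0) !gt_eqF ?powR_gt0 ?ltr0n.
Qed.

(** * Monotonicity and concavity of the weight *)

Lemma harmS (R : realType) n : harm R n.+1 = harm R n + n.+1%:R^-1.
Proof. by rewrite /harm big_nat_recr. Qed.

Lemma harmD (R : realType) n t :
  harm R (n + t) = harm R n + \sum_(j < t) (n + j).+1%:R^-1.
Proof.
elim: t => [|t IH]; first by rewrite addn0 big_ord0 addr0.
by rewrite addnS harmS IH big_ord_recr /= addrA.
Qed.

Lemma harm_lt (R : realType) m n : (m < n)%N -> harm R m < harm R n.
Proof.
move=> lt_mn; rewrite -(subnKC lt_mn) addSnnS harmD ltrDl big_ord_recl /=.
by rewrite ltr_pwDl ?invr_gt0 ?ltr0n // sumr_ge0 // => j _; rewrite invr_ge0.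
Qed.

(** The increments satisfy [sa <= sb] while [h_b < h_a], so [sa h_b < sb h_a]. The logarithm of this
    inequality is strict concavity of the weight. *)
Lemma harm_exchange (R : realType) a b t : (0 < b < a)%N -> (0 < t)%N ->
  harm R (a + t) * harm R b < harm R a * harm R (b + t).
Proof.
move=> /andP[b0 ba] t0; rewrite !harmD.
have lt_h := harm_lt R b a ba; have hb := harm_pos R b b0.
set sa := \sum_(j < t) _; set sb := \sum_(j < t) _.
have le_s : sa <= sb.
  apply: ler_sum => j _; rewrite lef_pV2 ?posrE ?ltr0n // ler_nat ltnS.
  by rewrite leq_add2r ltnW.
have sb0 : 0 < sb.
  have := harm_lt R b (b + t); rewrite harmD ltrDl; apply.
  by rewrite -[ltnLHS]addn0 ltn_add2l.
rewrite mulrDl mulrDr ltrD2l (@le_lt_trans _ _ (sb * harm R b)) //.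
  by rewrite ler_wpM2r // ltW.
by rewrite mulrC ltr_pM2r.
Qed.

Lemma ln2_gt0 (R : realType) : 0 < ln 2 :> R.
Proof. by rewrite ln_gt0 // ltr1n. Qed.

Lemma log2_lt (R : realType) (x y : R) : 0 < x -> x < y -> log2 x < log2 y.
Proof.
move=> x0 xy; rewrite ltr_pM2r ?invr_gt0 ?ln2_gt0 // ltr_ln ?posrE //.
exact: lt_trans xy.
Qed.

Lemma log2_le (R : realType) (x y : R) : 0 < x -> x <= y -> log2 x <= log2 y.
Proof. by move=> x0; rewrite le_eqVlt => /predU1P[->|/(log2_lt _ _ _ x0)/ltW]. Qed.

Lemma log2M (R : realType) (x y : R) : 0 < x -> 0 < y ->
  log2 (x * y) = log2 x + log2 y.
Proof. by move=> x0 y0; rewrite /log2 lnM ?posrE // mulrDl. Qed.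

Lemma split_cost_incr (R : realType) m n : (1 < m < n)%N ->
  split_cost R m < split_cost R n.
Proof.
by move=> h; apply: log2_lt; [apply: harm_pos|apply: harm_lt]; lia.
Qed.

Lemma split_cost_conc (R : realType) a b t : (1 < b < a)%N -> (0 < t)%N ->
  split_cost R (a + t) + split_cost R b < split_cost R a + split_cost R (b + t).
Proof.
case: a b => [|a] [|b] h t0; [lia|lia|lia|rewrite /split_cost !addSn /=].
have hp n : (0 < n)%N -> 0 < harm R n by exact: harm_pos.
have [ha hb hat hbt] : [/\ 0 < harm R a, 0 < harm R b,
    0 < harm R (a + t) & 0 < harm R (b + t)].
  by split; apply: hp; lia.
rewrite -(log2M _ _ _ hat hb) -(log2M _ _ _ ha hbt).
by apply: log2_lt; [rewrite mulr_gt0|apply: harm_exchange; lia].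
Qed.

Lemma DTCS_maximal_iff (R : realType) (k : nat) (T : tree) :
  (0 < k)%N -> tree_size T = k ->
  (forall T' : tree, tree_size T' = k -> (DTCS R k [set T'] <= DTCS R k [set T])%E) <->
  is_ordering_of T (CBT k).
Proof.
move=> k0 eT; have key T' : tree_size T' = k ->
    (DTCS R k [set T'] <= DTCS R k [set T])%E =
    (cost R (split_cost R) T <= cost R (split_cost R) T').
  move=> eT'; rewrite -{1}eT' -eT !DTCS_cost eT eT' lee_fin ler_pM2l ?ltr0n //.
  rewrite /powR pnatr_eq0 /= ler_expR ler_pM2r ?ln2_gt0 //.
  by rewrite lerD2l lerN2.
rewrite -eT -(cost_minimal_iff R (split_cost R)); last 2 first.
- exact: split_cost_incr.
- exact: split_cost_conc.
by rewrite eT; split=> h T' eT'; [rewrite -key //|rewrite key //]; apply: h.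
Qed.

(** * Cost of the complete binary tree *)

Lemma harm_le (R : realType) n : harm R n <= n%:R.
Proof.
elim: n => [|n IH]; first by rewrite /harm big_geq.
by rewrite harmS -[leRHS]natr1 lerD // invf_le1 ?ltr0n ?ler1n.
Qed.

Lemma log2_exp2 (R : realType) n : log2 (2 ^+ n : R) = n%:R.
Proof. by rewrite /log2 lnXn ?ltr0n // -[_ *+ n]mulr_natl mulfK // gt_eqF // ln2_gt0. Qed.

Lemma split_cost_ge0 (R : realType) m : (1 < m)%N -> 0 <= split_cost R m.
Proof.
move=> m1; rewrite -[0]/(0%:R) -(log2_exp2 R 0) expr0; apply: log2_le => //.
have : harm R 1 = 1 by rewrite /harm big_nat1 invr1.
case: m m1 => [|[|[|m]]] // _ <- //.
by rewrite ltW // harm_lt.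
Qed.

Lemma split_cost_le (R : realType) d m : (1 < m <= 2 ^ d)%N -> split_cost R m <= d%:R.
Proof.
move=> /andP[m1 md]; rewrite -(log2_exp2 R); apply: log2_le; first by apply: harm_pos; lia.
apply: le_trans (harm_le R _) _; rewrite -natrX ler_nat; lia.
Qed.

Lemma alpha_termE (R : realType) n :
  alpha_term R n = split_cost R (2 ^ n.+1) / 2 ^+ n.+1.
Proof. by rewrite /alpha_term /split_cost subn1. Qed.

Lemma expn2_gt1 n : (1 < 2 ^ n.+1)%N.
Proof. by have := expn_gt0 2 n; rewrite expnS; lia. Qed.

Lemma alpha_term_ge0 (R : realType) n : 0 <= alpha_term R n.
Proof. by rewrite alpha_termE divr_ge0 ?split_cost_ge0 ?expn2_gt1 // exprn_ge0. Qed.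

Lemma series_alphaS (R : realType) n :
  series (alpha_term R) n.+1 = series (alpha_term R) n + alpha_term R n.
Proof. by rewrite /series /= big_nat_recr. Qed.

Lemma series_alpha_nd (R : realType) : nondecreasing_seq (series (alpha_term R)).
Proof. by apply/nondecreasing_seqP => n; rewrite series_alphaS lerDl alpha_term_ge0. Qed.

(** The terms are at most [(i + 1) / 2^(i + 1)], which sum to [(n + 2) / 2^n] over [i >= n]; a
    partial sum plus this remainder is nonincreasing. *)
Lemma series_alpha_tail (R : realType) n k :
  series (alpha_term R) (n + k)%N <= series (alpha_term R) n + (n.+2)%:R / 2 ^+ n.
Proof.
have mono m : series (alpha_term R) m.+1 + m.+3%:R / 2 ^+ m.+1 <=
    series (alpha_term R) m + m.+2%:R / 2 ^+ m.
  rewrite series_alphaS -addrA lerD2l alpha_termE -mulrDl exprS invfM mulrA.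
  rewrite ler_wpM2r ?invr_ge0 ?exprn_ge0 //.
  have := split_cost_le R m.+1 (2 ^ m.+1).
  rewrite leqnn andbT expn2_gt1 => /(_ isT).
  by rewrite -[m.+3%:R]natr1 -[m.+2%:R]natr1 -[m.+1%:R]natr1; lra.
suff : series (alpha_term R) (n + k)%N + (n + k).+2%:R / 2 ^+ (n + k)%N <=
    series (alpha_term R) n + n.+2%:R / 2 ^+ n.
  by move=> h; apply: le_trans h; rewrite lerDl divr_ge0 // exprn_ge0.
elim: k => [|k IH]; first by rewrite addn0.
by rewrite addnS; apply: le_trans (mono _) IH.
Qed.

Lemma cvg_series_alpha (R : realType) : cvgn (series (alpha_term R)).
Proof.
apply: nondecreasing_is_cvgn; first exact: series_alpha_nd.
exists 2 => _ [n _ <-]; have := series_alpha_tail R 0 n.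
by rewrite add0n [series _ 0]/series /= big_geq // add0r expr0 divr1.
Qed.

Lemma lim_series_alpha_ge (R : realType) n :
  series (alpha_term R) n <= limn (series (alpha_term R)).
Proof.
apply: nondecreasing_cvgn_le; [exact: series_alpha_nd|exact: cvg_series_alpha].
Qed.

Lemma lim_series_alpha_le (R : realType) n M :
  (forall k, series (alpha_term R) (n + k)%N <= M) -> limn (series (alpha_term R)) <= M.
Proof.
move=> h; apply: limr_le; first exact: cvg_series_alpha.
exists n => // k /= nk; by rewrite -(subnKC nk).
Qed.

Lemma cost_fill0 (R : realType) d :
  cost R (split_cost R) (fill d 0) = 2 ^+ d * series (alpha_term R) d.
Proof.
elim: d => [|d IH]; first by rewrite /series /= big_geq // mulr0.
have -> : fill d.+1 0 = Node (fill d 0) (fill d 0) by rewrite /= min0n sub0n.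
rewrite [LHS]/= !IH !tree_size_fill // !addn0 addnn -mul2n -expnS.
rewrite series_alphaS alpha_termE exprS; field.
by rewrite expf_neq0 // pnatr_eq0.
Qed.

(** The error is [2 ^ d] times the tail of the series. *)
Lemma cost_fill0_err (R : realType) d :
  `|cost R (split_cost R) (fill d 0) - limn (series (alpha_term R)) * 2 ^+ d| <= d.+2%:R.
Proof.
have p0 : 0 < 2 ^+ d :> R by rewrite exprn_gt0.
have h1 := lim_series_alpha_ge R d.
have h2 := lim_series_alpha_le R d _ (series_alpha_tail R d).
rewrite cost_fill0 [_ * series _ _]mulrC -mulrBl normrM distrC (gtr0_norm p0).
by rewrite ger0_norm ?subr_ge0 // -ler_pdivlMr // lerBlDl.
Qed.

(** One of the two subtrees is always full. The root weight and the error of the full subtree add at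
    most [(d + 2) + (d + 3) = (d + 3)^2 - (d + 2)^2]. *)
Lemma cost_fill_err (R : realType) d e : (e <= 2 ^ d)%N ->
  `|cost R (split_cost R) (fill d e) - limn (series (alpha_term R)) * (2 ^ d + e)%:R|
    <= d.+2%:R ^+ 2.
Proof.
set beta := limn _.
elim: d e => [|d IH] e.
  case: e => [|[|e]] // _.
    apply: le_trans (cost_fill0_err R 0) _; rewrite expr2; lra.
  rewrite (fill_full 0); have := cost_fill0_err R 1.
  rewrite expr1 addn1 -/beta => /le_trans; apply; lra.
move=> he; have sz := tree_size_fill he.
have c0 : 0 <= split_cost R (2 ^ d.+1 + e).
  by apply: split_cost_ge0; have := expn2_gt1 d; lia.
have c1 : split_cost R (2 ^ d.+1 + e) <= d%:R + 1 + 1.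
  by rewrite !natr1; apply: split_cost_le; have := expn2_gt1 d;
    move: he; rewrite (expnS _ d.+1); lia.
have [le_e|lt_e] := leqP e (2 ^ d).
  have -> : cost R (split_cost R) (fill d.+1 e) = split_cost R (2 ^ d.+1 + e) +
      cost R (split_cost R) (fill d e) + cost R (split_cost R) (fill d 0).
    rewrite -sz /= (minn_idPl le_e) (_ : (e - 2 ^ d)%N = 0%N) //.
    by apply/eqP.
  have := IH _ le_e; have := cost_fill0_err R d; rewrite -/beta !natrD !natrX [2 ^+ d.+1]exprS.
  rewrite !ler_norml -?[d.+3%:R]natr1 -[d.+2%:R]natr1 -[d.+1%:R]natr1.
  set q := 2 ^+ d => /andP[h1 h2] /andP[h3 h4]; apply/andP; split; nra.
have -> : cost R (split_cost R) (fill d.+1 e) = split_cost R (2 ^ d.+1 + e) +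
    cost R (split_cost R) (fill d.+1 0) + cost R (split_cost R) (fill d (e - 2 ^ d)).
  rewrite -sz -(fill_full d) [fill d.+1 e]/= (minn_idPr (ltnW lt_e)) //.
have le_e' : (e - 2 ^ d <= 2 ^ d)%N by move: he; rewrite expnS; lia.
have := IH _ le_e'; have := cost_fill0_err R d.+1.
rewrite subnKC ?(ltnW lt_e) // -/beta natrD natrX [2 ^+ d.+1]exprS.
rewrite !ler_norml -?[d.+3%:R]natr1 -[d.+2%:R]natr1 -[d.+1%:R]natr1.
set q := 2 ^+ d => /andP[h1 h2] /andP[h3 h4]; apply/andP; split; nra.
Qed.

(** Turns an error [(d + 3)^2 / 2^d] into [64 / (d + 3)]. *)
Lemma cube_le_exp2 d : ((d + 3) ^ 3 <= 64 * 2 ^ d)%N.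
Proof.
elim: d => [//|[|d] IH] //.
by move: IH; rewrite [(2 ^ d.+2)%N]expnS; move: (2 ^ d.+1)%N => q; nia.
Qed.

(** Obtained by solving [log2 k + 1 - k - c = - (alpha + eps) k] for [eps], with [c] the cost of
    [CBT k]. *)
Definition cbt_eps (R : realType) (k : nat) : R :=
  (cost R (split_cost R) (CBT k) - limn (series (alpha_term R)) * k%:R
     - log2 k%:R - 1) / k%:R.

Lemma DTCS_CBT (R : realType) k : (0 < k)%N ->
  DTCS R k [set CBT k] = (2 `^ (- (alpha R + cbt_eps R k) * k%:R))%:E.
Proof.
move=> k0; rewrite -{1}(tree_size_CBT k0) DTCS_cost tree_size_CBT //.
have kR : 0 < k%:R :> R by rewrite ltr0n.
rewrite -{1}(powR2_log2 R k%:R kR) -powRD ?pnatr_eq0 ?implybT //.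
congr (2 `^ _)%:E; rewrite /cbt_eps /alpha; field.
by rewrite gt_eqF.
Qed.

Lemma cbt_eps_le (R : realType) k : (0 < k)%N ->
  `|cbt_eps R k| <= 64 / (trunc_log 2 k + 3)%:R.
Proof.
move=> k0; have kR : 0 < k%:R :> R by rewrite ltr0n.
have /andP[le_k lt_k] := trunc_log_bounds (ltnSn 1) k0.
rewrite /cbt_eps normrM normfV (gtr0_norm kR) ler_pdivrMr //.
have := @cost_fill_err R (trunc_log 2 k) (k - 2 ^ trunc_log 2 k).
rewrite subnKC // -/(CBT k) leq_subLR addnn -mul2n -expnS => /(_ (ltnW lt_k)).
have := cube_le_exp2 (trunc_log 2 k).
set d := trunc_log 2 k in le_k lt_k *; set beta := limn _; set c := cost _ _ _.
move=> cube err.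
have l0 : 0 <= log2 k%:R :> R.
  by rewrite /log2 divr_ge0 ?ln_ge0 ?ler1n.
have l1 : log2 k%:R <= d.+1%:R :> R.
  by rewrite -[d.+1%:R]log2_exp2; apply: log2_le; rewrite // -natrX ler_nat ltnW.
(* The cost error is at most [(d + 2)^2], and [log2 k + 1 <= d + 2]. *)
apply: (@le_trans _ _ ((d + 3)%:R ^+ 2)).
  move: err l1; rewrite !ler_norml -[d.+2%:R]natr1 -[d.+1%:R]natr1 natrD.
  by move=> /andP[h1 h2] h3; apply/andP; split; nra.
rewrite mulrAC ler_pdivlMr ?ltr0n ?addn3 // -exprSr -natrX -natrM ler_nat -addn3.
by apply: leq_trans cube _; rewrite leq_mul2l le_k orbT.
Qed.

Lemma cbt_eps_cvg (R : realType) : cbt_eps R k @[k --> \oo] --> 0.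
Proof.
apply/cvgrPdist_le => e e0.
have [M hM] : exists M : nat, 64 / e <= M%:R.
  by exists (Num.truncn (64 / e)).+1; rewrite ltW // truncnS_gt.
exists (2 ^ M)%N => // k /= le_k; rewrite sub0r normrN.
have k0 : (0 < k)%N by apply: leq_trans le_k; rewrite expn_gt0.
apply: le_trans (cbt_eps_le R k k0) _.
rewrite ler_pdivrMr ?ltr0n ?addn3 // -ler_pdivrMl // mulrC (le_trans hM) // ler_nat -addn3.
have : (M <= trunc_log 2 k)%N by rewrite -{1}(@trunc_expnK 2 M) ?leq_trunc_log.
lia.
Qed.

(** * Numerical bounds *)

(** Equals [h_{2m-1} - h_{m-1}], the increment between the harmonic numbers of consecutive terms of
    the series; an upper Riemann sum for [ln 2]. *)
Definition harm_block (R : realType) (m : nat) : R := \sum_(j < m) (m + j)%:R^-1.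

Lemma harm_double (R : realType) m :
  harm R (2 * m.+1 - 1) = harm R (m.+1 - 1) + harm_block R m.+1.
Proof. by rewrite (_ : (2 * m.+1 - 1)%N = (m + m.+1)%N) ?harmD ?subn1 //; lia. Qed.

Lemma sum_double (V : zmodType) (F : nat -> V) m :
  \sum_(j < 2 * m) F j = \sum_(j < m) (F (2 * j)%N + F (2 * j).+1).
Proof.
elim: m => [|m IH]; first by rewrite muln0 !big_ord0.
by rewrite mulnS !addSn add0n !big_ord_recr /= IH addrA.
Qed.

Lemma harm_block_double (R : realType) m : harm_block R (2 * m) =
  \sum_(j < m) ((2 * (m + j))%:R^-1 + (2 * (m + j)).+1%:R^-1).
Proof.
rewrite /harm_block (sum_double _ (fun j => (2 * m + j)%:R^-1)).
by apply: eq_bigr => j _; rewrite addnS mulnDr.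
Qed.

Lemma telescope_ord (V : zmodType) (F : nat -> V) m k :
  \sum_(j < k) (F (m + j)%N - F (m + j).+1) = F m - F (m + k)%N.
Proof.
elim: k => [|k IH]; first by rewrite big_ord0 addn0 subrr.
by rewrite big_ord_recr /= IH addnS addrA subrK.
Qed.

(** Doubling replaces [1/x] by [1/(2x) + 1/(2x+1)], a loss of at least [1/(4x) - 1/(4(x+1))], which
    telescopes. *)
Lemma harm_block_double_le (R : realType) m : (0 < m)%N ->
  harm_block R (2 * m) <= harm_block R m - 1 / (8 * m%:R).
Proof.
move=> m0; have mR : 0 < m%:R :> R by rewrite ltr0n.
have -> : 1 / (8 * m%:R) =
    \sum_(j < m) ((4 * (m + j)%:R)^-1 - (4 * (m + j).+1%:R)^-1) :> R.
  rewrite (telescope_ord _ (fun j => (4 * j%:R)^-1)) natrD; field; lra.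
rewrite harm_block_double -sumrB; apply: ler_sum => j _.
have : 0 < (m + j)%:R :> R by rewrite ltr0n addn_gt0 m0.
rewrite -[(2 * (m + j)).+1%:R]natr1 -[(m + j).+1%:R]natr1 natrM.
move: (_%:R : R) => x x0; rewrite -subr_ge0.
have -> : x^-1 - ((4 * x)^-1 - (4 * (x + 1))^-1) - ((2 * x)^-1 + (2 * x + 1)^-1) =
    1 / (4 * x * (x + 1) * (2 * x + 1)) by field; rewrite !gt_eqF //; lra.
by rewrite divr_ge0 // !mulr_ge0 //; lra.
Qed.

(** The second term of [G] makes [G x - G (x + 1)] exceed the loss [1/x - 1/(2x) - 1/(2x+1)] by a
    term of order [x^-5] only. *)
Lemma harm_block_double_ge (R : realType) m : (0 < m)%N ->
  harm_block R m - 1 / (8 * m%:R) - 3 / (64 * m%:R ^+ 2) <= harm_block R (2 * m).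
Proof.
move=> m0; have mR : 0 < m%:R :> R by rewrite ltr0n.
pose G j : R := (4 * j%:R)^-1 + (16 * j%:R ^+ 2)^-1.
have E : 1 / (8 * m%:R) + 3 / (64 * m%:R ^+ 2) =
    \sum_(j < m) (G (m + j)%N - G (m + j).+1) :> R.
  by rewrite telescope_ord /G natrD; field; lra.
rewrite -addrA -opprD E harm_block_double -sumrB; apply: ler_sum => j _.
have : 0 < (m + j)%:R :> R by rewrite ltr0n addn_gt0 m0.
rewrite /G -[(2 * (m + j)).+1%:R]natr1 -[(m + j).+1%:R]natr1 natrM.
move: (_%:R : R) => x x0; rewrite -subr_ge0.
have -> : (2 * x)^-1 + (2 * x + 1)^-1 - (x^-1 - ((4 * x)^-1 + (16 * x ^+ 2)^-1 -
      ((4 * (x + 1))^-1 + (16 * (x + 1) ^+ 2)^-1))) =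
    1 / (16 * x ^+ 2 * (x + 1) ^+ 2 * (2 * x + 1)) by field; rewrite !gt_eqF //; lra.
by rewrite divr_ge0 // !mulr_ge0 ?exprn_ge0 //; lra.
Qed.

(* [harm_block R m - 1 / (4 m) - 1 / (16 m ^ 2)] increases to [ln 2] when [m] is
   repeatedly doubled. *)
Lemma harm_block_ge (R : realType) m i : (0 < m)%N ->
  harm_block R m - 1 / (4 * m%:R) - 1 / (16 * m%:R ^+ 2)
    + 1 / (4 * (2 ^ i * m)%:R) + 1 / (16 * (2 ^ i * m)%:R ^+ 2)
  <= harm_block R (2 ^ i * m).
Proof.
move=> m0; elim: i => [|i IH]; first by rewrite expn0 mul1n; lra.
rewrite expnS -mulnA.
have q0 : (0 < 2 ^ i * m)%N by rewrite muln_gt0 expn_gt0.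
apply: le_trans (harm_block_double_ge R _ q0); rewrite natrM.
have : 0 < (2 ^ i * m)%:R :> R by rewrite ltr0n.
move: IH; move: ((2 ^ i * m)%:R : R) (harm_block R (2 ^ i * m)) => q s IH q0R.
move: IH; set u := harm_block R m - _ - _.
have -> : 1 / (4 * (2 * q)) = 1 / (8 * q) by field; lra.
have -> : 1 / (16 * (2 * q) ^+ 2) = 1 / (64 * q ^+ 2) by field; lra.
have -> : 1 / (4 * q) = 2 / (8 * q) by field; lra.
have -> : 1 / (16 * q ^+ 2) = 4 / (64 * q ^+ 2) by field; lra.
lra.
Qed.

Lemma harm_block_le (R : realType) m i : (0 < m)%N ->
  harm_block R (2 ^ i * m) <= harm_block R m.
Proof.
move=> m0; elim: i => [|i IH]; first by rewrite expn0 mul1n.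
have q0 : (0 < 2 ^ i * m)%N by rewrite muln_gt0 expn_gt0.
rewrite expnS -mulnA; apply: le_trans (harm_block_double_le R _ q0) _.
apply: le_trans IH; rewrite lerBlDr lerDl divr_ge0 // mulr_ge0 //.
Qed.

Lemma harm_pow2S (R : realType) i : harm R (2 ^ i.+2 - 1) =
  harm R (2 ^ i.+1 - 1) + harm_block R (2 ^ i.+1).
Proof.
rewrite (expnS 2 i.+1); have := expn_gt0 2 i.+1; case: (2 ^ i.+1)%N => // m _.
exact: harm_double.
Qed.

Lemma log2X (R : realType) (x : R) n : 0 < x -> log2 (x ^+ n) = n%:R * log2 x.
Proof. by move=> x0; rewrite /log2 lnXn // -[_ *+ n]mulr_natl mulrA. Qed.

Lemma harm_pow2_gt0 (R : realType) i : 0 < harm R (2 ^ i.+1 - 1).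
Proof. by apply: harm_pos; rewrite subn_gt0 expn2_gt1. Qed.

Lemma log2_1 (R : realType) : log2 (1 : R) = 0.
Proof. by rewrite /log2 ln1 mul0r. Qed.

Lemma sum_log2_harm (R : realType) k :
  \sum_(j < k) log2 (harm R (2 ^ j.+1 - 1)) / 2 ^+ j = 2 * series (alpha_term R) k.
Proof.
rewrite /series /= big_mkord mulr_sumr; apply: eq_bigr => j _.
by rewrite /alpha_term exprS; field; rewrite expf_neq0 // pnatr_eq0.
Qed.

(** * Upper bound on the tail of the series *)

Lemma harm15_le (R : realType) : harm R 15 <= 7 / 2.
Proof. rewrite !harmS /harm big_geq //; lra. Qed.

Lemma harm_block_pow2_le (R : realType) i : harm_block R (2 ^ (i + 3)) <= 3 / 4.
Proof.
rewrite expnD; apply: le_trans (harm_block_le R 8 i isT) _.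
rewrite /harm_block !big_ord_recr big_ord0 /= !(addnS, addn0); lra.
Qed.

Lemma harm_pow2_le (R : realType) k :
  harm R (2 ^ (3 + k).+1 - 1) <= 7 / 2 + k%:R * (3 / 4).
Proof.
elim: k => [|k IH]; first by rewrite mul0r addr0; exact: harm15_le.
rewrite addnS harm_pow2S; have := harm_block_pow2_le R k.+1.
by rewrite (_ : k.+1 + 3 = (3 + k).+1)%N -?[k.+1%:R]natr1; [lra|lia].
Qed.

(** Linear growth is traded for geometric growth, whose logarithm is linear in [k]: each step adds
    at most [3/4 = 8 * 3/32]. *)
Lemma harm_pow2_growth (R : realType) k :
  harm R (2 ^ (9 + k).+1 - 1) <= 8 * (1 + 3 / 32) ^+ k.
Proof.
elim: k => [|k IH].
  rewrite expr0 mulr1; apply: le_trans (harm_pow2_le R 6) _; lra.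
rewrite addnS harm_pow2S.
have block_le : harm_block R (2 ^ (9 + k).+1) <= 3 / 4.
  by rewrite (_ : (9 + k).+1 = 7 + k + 3)%N; [exact: harm_block_pow2_le|lia].
have : 1 <= (1 + 3 / 32) ^+ k :> R by apply: exprn_ege1; lra.
rewrite exprSr; lra.
Qed.

Lemma log2_harm_growth (R : realType) k :
  log2 (harm R (2 ^ (9 + k).+1 - 1)) <= 3 + k%:R / 7.
Proof.
apply: le_trans (log2_le _ _ _ (harm_pow2_gt0 R _) (harm_pow2_growth R k)) _.
have p0 : 0 < 1 + 3 / 32 :> R by lra.
rewrite log2M ?exprn_gt0 // log2X // (_ : 8 = 2 ^+ 3) ?log2_exp2; last by rewrite -natrX.
rewrite lerD2l ler_wpM2l //.
have : log2 ((1 + 3 / 32) ^+ 7) <= log2 (2 ^+ 1 : R).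
  by apply: log2_le; [rewrite exprn_gt0|lra].
rewrite (log2_exp2 R 1) log2X //; lra.
Qed.

Lemma series_alpha_tail9 (R : realType) k :
  series (alpha_term R) (9 + k)%N <= series (alpha_term R) 9 + 44 / 7 / 2 ^+ 10.
Proof.
(* The added remainder is the sum of [(3 + j/7) / 2^(10 + j)] over [j >= k]. *)
suff : series (alpha_term R) (9 + k)%N + (44 + 2 * k%:R) / 7 / 2 ^+ (9 + k).+1 <=
    series (alpha_term R) 9 + 44 / 7 / 2 ^+ 10.
  move=> h; apply: le_trans h; rewrite lerDl.
  by rewrite !divr_ge0 ?exprn_ge0 // addr_ge0 // mulr_ge0.
elim: k => [|k IH]; first by rewrite !addn0 mulr0 addr0.
apply: le_trans IH; rewrite addnS series_alphaS -addrA lerD2l.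
rewrite /alpha_term -[k.+1%:R]natr1 [2 ^+ (9 + k).+2]exprS.
have := log2_harm_growth R k; move: (log2 _) => l le_l.
have : 0 < 2 ^+ (9 + k).+1 :> R by rewrite exprn_gt0.
move: (2 ^+ _) => q q0; rewrite invfM.
have : 0 < q^-1 by rewrite invr_gt0.
by move: (q^-1) => i; nra.
Qed.

(** [80] is a round number just above [2^(44/7)], about [78]. *)
Lemma log2_80_ge (R : realType) : 44 <= 7 * log2 (80 : R).
Proof.
have le80 : (2 : R) ^+ 44 <= 80 ^+ 7 by lra.
have := log2_le _ _ _ (exprn_gt0 44 (ltr0n R 2)) le80.
have -> : log2 (80 ^+ 7 : R) = 7 * log2 80 by apply: log2X.
by move=> h; rewrite -[leLHS](log2_exp2 R 44).
Qed.

(** * Rounded evaluation of the nested radical *)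

Section FixedPoint.
Variables (R : realType) (P : N).

(* A number [a : N] stands for the real [a / P]; the suffixes [lo] and [up] tell
   whether operations are rounded down or up. *)

Fixpoint harm_lo (n : nat) : N :=
  if n is n'.+1 then (harm_lo n' + P / N.of_nat n)%num else 0%num.

Fixpoint harm_up (n : nat) : N :=
  if n is n'.+1 then (harm_up n' + (P / N.of_nat n + 1))%num else 0%num.

(* [harm_block 8 - 1/32 - 1/1024] bounds [ln 2] from below to within 2e-6, see
   [harm_block_ge]. *)
Definition block_lo : N :=
  (harm_lo 15 - (harm_up 7 + (P / 32 + 1) + (P / 1024 + 1)))%num.

Definition block_up : N := (harm_up 31 - harm_lo 15)%num.

(** Steps from [h_{2^(i+1)-1}] to [h_{2^(i+2)-1}]: past the small indices it adds the bound of
    [harm_block_ge] for a block of size [2^(i+1)], with [c] as its constant part. *)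
Definition next_lo (c : N) (i : nat) (x : N) : N :=
  if (i < 3)%N then harm_lo (2 ^ i.+2 - 1)
  else (x + c + P / 2 ^ N.of_nat (i + 3) + P / 2 ^ N.of_nat (2 * i + 6))%num.

Definition next_up (c : N) (i : nat) (x : N) : N :=
  if (i < 4)%N then harm_up (2 ^ i.+2 - 1) else (x + c)%num.

(** Each level [x sqrt r] is taken as one root of [x^2 r]. The innermost value [P] stands for 1,
    which drops the remaining nonnegative terms. *)
Fixpoint nested_lo (c : N) (k i : nat) (x : N) : N :=
  if k is k'.+1 then N.sqrt (x ^ 2 * nested_lo c k' i.+1 (next_lo c i x) / P)
  else P.

(* The tail of the series beyond its 9th term is at most [log2 80 / 2 ^ 10]; see
   [series_alpha_tail9]. *)
Fixpoint nested_up (c : N) (k i : nat) (x : N) : N :=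
  if k is k'.+1 then
    (N.sqrt (x ^ 2 * nested_up c k' i.+1 (next_up c i x) / P) + 1)%num
  else (80 * P)%num.

Definition pow_lo (a : N) (n : nat) : N :=
  (a ^ N.of_nat n * P / P ^ N.of_nat n)%num.

Hypothesis P0 : P <> 0%num.

Definition fp_val (a : N) : R := (N.to_nat a)%:R / (N.to_nat P)%:R.

Lemma fp_unit_gt0 : 0 < (N.to_nat P)%:R :> R.
Proof. by rewrite ltr0n; lia. Qed.

Lemma fp_val_le a b : (a <= b)%num -> fp_val a <= fp_val b.
Proof. by move=> ab; rewrite ler_pM2r ?invr_gt0 ?fp_unit_gt0 // ler_nat; lia. Qed.

Lemma fp_val_ge0 a : 0 <= fp_val a.
Proof. by rewrite divr_ge0 // ltW // fp_unit_gt0. Qed.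

Lemma fp_valD a b : fp_val (a + b) = fp_val a + fp_val b.
Proof. by rewrite /fp_val N2Nat.inj_add natrD mulrDl. Qed.

Lemma fp_val1 : fp_val P = 1.
Proof. by rewrite /fp_val divff // gt_eqF // fp_unit_gt0. Qed.

Lemma fp_val_mul_unit n : fp_val (n * P) = (N.to_nat n)%:R.
Proof.
rewrite /fp_val (_ : N.to_nat (n * P) = (N.to_nat n * N.to_nat P)%N); last by lia.
by rewrite natrM mulfK // gt_eqF // fp_unit_gt0.
Qed.

Lemma fp_val_sub_ge a b : fp_val a - fp_val b <= fp_val (a - b).
Proof. by rewrite lerBlDr -fp_valD; apply: fp_val_le; lia. Qed.

Lemma fp_val_div_le n : n <> 0%num -> fp_val (P / n) <= (N.to_nat n)%:R^-1.
Proof.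
move=> n0; rewrite ler_pdivrMr ?fp_unit_gt0 // ler_pdivlMl ?ltr0n; last by lia.
by rewrite -natrM ler_nat; have := N.Div0.mul_div_le P n; lia.
Qed.

Lemma fp_val_div_ge n : n <> 0%num -> (N.to_nat n)%:R^-1 <= fp_val (P / n + 1).
Proof.
move=> n0; rewrite ler_pdivlMr ?fp_unit_gt0 // ler_pdivrMl ?ltr0n; last by lia.
by rewrite -natrM ler_nat; have := N.mul_succ_div_gt P n n0; lia.
Qed.

Lemma to_nat_pow a n : (N.to_nat (a ^ N.of_nat n))%:R = (N.to_nat a)%:R ^+ n :> R.
Proof.
elim: n => [|n IH]; first by rewrite N.pow_0_r.
by rewrite Nat2N.inj_succ N.pow_succ_r' N2Nat.inj_mul natrM IH exprS.
Qed.

Lemma fp_val_sub_le a b r : 0 <= r -> fp_val a <= r + fp_val b -> fp_val (a - b) <= r.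
Proof.
move=> r0 h; case: (N.le_ge_cases b a) => ab; last first.
  by rewrite (_ : (a - b)%num = 0%num); [rewrite /fp_val mul0r|lia].
by rewrite -(lerD2r (fp_val b)) -fp_valD N.sub_add.
Qed.

Lemma fp_val_sqrt_le a b :
  fp_val (N.sqrt (a ^ 2 * b / P)) ^+ 2 <= fp_val a ^+ 2 * fp_val b.
Proof.
set s := N.sqrt _.
have h1 : (s * s <= a ^ 2 * b / P)%num.
  by have := N.sqrt_spec _ (N.le_0_l (a ^ 2 * b / P)); rewrite -/s; lia.
have h2 := N.Div0.mul_div_le (a ^ 2 * b) P.
have h : (N.to_nat P * (N.to_nat s * N.to_nat s) <=
    N.to_nat a * N.to_nat a * N.to_nat b)%N.
  by move: h1 h2; rewrite N.pow_2_r; move: (_ / _)%num => q; nia.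
move: h; rewrite /fp_val -(ler_nat R) !natrM; move: fp_unit_gt0.
move: (_%:R : R) (_%:R : R) (_%:R : R) (_%:R : R) => u v w z z0 h.
rewrite -subr_ge0 (_ : _ - _ = (v * v * u - z * (w * w)) / z ^+ 3); last by field; lra.
by rewrite divr_ge0 ?subr_ge0 // exprn_ge0 // ltW.
Qed.

(** The single [+ 1] also covers the rounded division: for integers, [q < (s + 1)^2] gives
    [q + 1 <= (s + 1)^2]. *)
Lemma fp_val_sqrt_ge a b : fp_val a ^+ 2 * fp_val b <=
  fp_val (N.sqrt (a ^ 2 * b / P) + 1) ^+ 2.
Proof.
set s := N.sqrt _.
have h1 : (a ^ 2 * b / P + 1 <= (s + 1) * (s + 1))%num.
  by have := N.sqrt_spec _ (N.le_0_l (a ^ 2 * b / P)); rewrite -/s; lia.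
have h2 := N.mul_succ_div_gt (a ^ 2 * b) P P0.
have h : (N.to_nat a * N.to_nat a * N.to_nat b <=
    N.to_nat P * (N.to_nat (s + 1) * N.to_nat (s + 1)))%N.
  by move: h1 h2; rewrite N.pow_2_r; move: (_ / _)%num (s + 1)%num => q t; nia.
move: h; rewrite /fp_val -(ler_nat R) !natrM; move: fp_unit_gt0.
move: (_%:R : R) (_%:R : R) (_%:R : R) (_%:R : R) => u v w z z0 h.
rewrite -subr_ge0 (_ : _ - _ = (z * (u * u) - w * w * v) / z ^+ 3); last by field; lra.
by rewrite divr_ge0 ?subr_ge0 // exprn_ge0 // ltW.
Qed.

Lemma harm_lo_le n : fp_val (harm_lo n) <= harm R n.
Proof.
elim: n => [|n IH]; first by rewrite /fp_val mul0r harm_ge0.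
rewrite harmS fp_valD lerD //; apply: le_trans (fp_val_div_le _ _) _; first by lia.
by rewrite Nat2N.id.
Qed.

Lemma harm_up_ge n : harm R n <= fp_val (harm_up n).
Proof.
elim: n => [|n IH]; first by rewrite /harm big_geq // fp_val_ge0.
rewrite harmS fp_valD lerD //; apply: le_trans (fp_val_div_ge _ _); last by lia.
by rewrite Nat2N.id.
Qed.


Lemma harm_block8 : harm_block R 8 = harm R 15 - harm R 7.
Proof. by rewrite (harm_double R 7 : harm R 15 = harm R 7 + _) addrC addKr. Qed.

Lemma harm_block16 : harm_block R 16 = harm R 31 - harm R 15.
Proof. by rewrite (harm_double R 15 : harm R 31 = harm R 15 + _) addrC addKr. Qed.

Lemma block_lo_le :
  fp_val block_lo <= harm_block R 8 - 1 / (4 * 8) - 1 / (16 * 8 ^+ 2).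
Proof.
apply: fp_val_sub_le.
  have : 8^-1 <= harm_block R 8.
    by rewrite /harm_block big_ord_recl addn0 lerDl sumr_ge0 // => j _; rewrite invr_ge0.
  lra.
rewrite harm_block8 (fp_valD _ (P / 1024 + 1)) (fp_valD _ (P / 32 + 1)).
have h1 := harm_lo_le 15; have h2 := harm_up_ge 7.
have h3 : 32^-1 <= fp_val (P / 32 + 1) by apply: (fp_val_div_ge 32).
have h4 : 1024^-1 <= fp_val (P / 1024 + 1) by apply: (fp_val_div_ge 1024).
lra.
Qed.

Lemma next_lo_le i x : fp_val x <= harm R (2 ^ i.+1 - 1) ->
  fp_val (next_lo block_lo i x) <= harm R (2 ^ i.+2 - 1).
Proof.
rewrite /next_lo; case: ltnP => [_ _|]; first exact: harm_lo_le.
case: i => [|[|[|n]]] // _ hx.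
rewrite harm_pow2S 3!fp_valD -!addrA lerD //.
have pow0 m : (2 ^ N.of_nat m)%num <> 0%num by apply: N.pow_nonzero.
have h1 := fp_val_div_le _ (pow0 (n.+3 + 3)%N).
have h2 := fp_val_div_le _ (pow0 (2 * n.+3 + 6)%N).
have := harm_block_ge R 8 n.+1 isT; have := block_lo_le.
(* With [i = n + 3], the block of size [2^(i+1)] is [n + 1] doublings of the block of size 8. *)
rewrite (_ : 2 ^ n.+1 * 8 = 2 ^ n.+4)%N; last by rewrite -(expnD 2 _ 3) addn3.
move: h1 h2; rewrite !to_nat_pow (_ : (N.to_nat 2)%:R = 2) //.
rewrite natrX (_ : n.+3 + 3 = n.+4 + 2)%N; last by lia.
rewrite (_ : 2 * n.+3 + 6 = n.+4 * 2 + 4)%N; last by lia.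
rewrite !exprD exprM.
set q := 2 ^+ n.+4; have q0 : 0 < q by rewrite exprn_gt0.
have -> : (q * 2 ^+ 2)^-1 = 1 / (4 * q) by field; lra.
have -> : (q ^+ 2 * 2 ^+ 4)^-1 = 1 / (16 * q ^+ 2) by field; lra.
lra.
Qed.

Lemma next_up_ge i x : harm R (2 ^ i.+1 - 1) <= fp_val x ->
  harm R (2 ^ i.+2 - 1) <= fp_val (next_up block_up i x).
Proof.
rewrite /next_up; case: ltnP => [_ _|]; first exact: harm_up_ge.
case: i => [|[|[|[|n]]]] // _ hx.
rewrite harm_pow2S fp_valD lerD //.
apply: le_trans (fp_val_sub_ge _ _).
rewrite (_ : 2 ^ n.+4.+1 = 2 ^ n.+1 * 16)%N; last by rewrite -(expnD 2 _ 4) addn4.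
apply: le_trans (harm_block_le R 16 n.+1 isT) _.
by rewrite harm_block16 lerB // ?harm_up_ge ?harm_lo_le.
Qed.

Let lx i : R := log2 (harm R (2 ^ i.+1 - 1)).

(** Horner form of the sum, matching [log2 (x sqrt r) = log2 x + (log2 r) / 2] at each level of the
    radical. *)
Lemma sum_halved k i : \sum_(j < k.+1) lx (i + j)%N / 2 ^+ j =
  lx i + (\sum_(j < k) lx (i.+1 + j)%N / 2 ^+ j) / 2.
Proof.
rewrite big_ord_recl addn0 expr0 divr1 mulr_suml; congr +%R.
apply: eq_bigr => j _; rewrite lift0 addnS addSn exprS; field.
by rewrite expf_neq0 // pnatr_eq0.
Qed.

Lemma fp_val_gt0 a : a <> 0%num -> 0 < fp_val a.
Proof. by move=> a0; rewrite divr_gt0 ?fp_unit_gt0 // ltr0n; lia. Qed.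

Lemma nested_lo_le k i x : fp_val x <= harm R (2 ^ i.+1 - 1) ->
  nested_lo block_lo k i x <> 0%num ->
  log2 (fp_val (nested_lo block_lo k i x)) <= \sum_(j < k) lx (i + j)%N / 2 ^+ j.
Proof.
elim: k i x => [|k IH] i x hx r0; first by rewrite /= fp_val1 log2_1 big_ord0.
move: r0; rewrite [nested_lo _ _ _ _]/=; set r' := nested_lo _ k _ _.
set r := N.sqrt _ => r0.
have r'0 : r' <> 0%num by move=> e; apply: r0; rewrite /r e N.mul_0_r.
have le_r : fp_val r ^+ 2 <= harm R (2 ^ i.+1 - 1) ^+ 2 * fp_val r'.
  apply: le_trans (fp_val_sqrt_le x r') _; rewrite ler_wpM2r ?fp_val_ge0 //.
  by rewrite lerXn2r ?nnegrE ?fp_val_ge0 ?harm_ge0.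
have h := harm_pow2_gt0 R i; have g0 := fp_val_gt0 _ r0; have g1 := fp_val_gt0 _ r'0.
have := log2_le _ _ _ (exprn_gt0 2 g0) le_r.
rewrite sum_halved log2M ?exprn_gt0 // !log2X // -/(lx i).
move: (IH i.+1 (next_lo block_lo i x) (next_lo_le i x hx) r'0); rewrite -/r'; lra.
Qed.

Lemma nested_up_neq0 c k i x : nested_up c k i x <> 0%num.
Proof.
case: k => [|k]; first by change (80 * P <> 0)%num; lia.
by rewrite /=; set s := N.sqrt _; lia.
Qed.

Lemma nested_up_ge k i x : harm R (2 ^ i.+1 - 1) <= fp_val x ->
  \sum_(j < k) lx (i + j)%N / 2 ^+ j + log2 80 / 2 ^+ k <=
    log2 (fp_val (nested_up block_up k i x)).
Proof.
elim: k i x => [|k IH] i x hx.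
  rewrite big_ord0 add0r divr1 (_ : nested_up _ 0 i x = (80 * P)%num) //.
  by rewrite fp_val_mul_unit.
have r0 := nested_up_neq0 block_up k.+1 i x.
move: r0; rewrite [nested_up _ k.+1 _ _]/=.
have r'0 := nested_up_neq0 block_up k i.+1 (next_up block_up i x).
move: r'0 (IH i.+1 (next_up block_up i x) (next_up_ge i x hx)).
move: (nested_up _ k _ _) => r' r'0 le_r'; set r := (N.sqrt _ + 1)%num => r0.
have le_r : harm R (2 ^ i.+1 - 1) ^+ 2 * fp_val r' <= fp_val r ^+ 2.
  apply: le_trans _ (fp_val_sqrt_ge x r'); rewrite ler_wpM2r ?fp_val_ge0 //.
  by rewrite lerXn2r ?nnegrE ?fp_val_ge0 ?harm_ge0.
have h := harm_pow2_gt0 R i; have g0 := fp_val_gt0 _ r0; have g1 := fp_val_gt0 _ r'0.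
have := log2_le _ _ _ (mulr_gt0 (exprn_gt0 2 h) g1) le_r.
rewrite sum_halved log2M ?exprn_gt0 // !log2X // -/(lx i); move: le_r'.
rewrite exprS invfM; set t := log2 80 / _; set t' := log2 80 * _.
have -> : t' = t / 2 by rewrite /t' /t mulrC -mulrA mulrC [_^-1 * _]mulrC.
lra.
Qed.

Lemma pow_lo_le a n : a <> 0%num -> pow_lo a n <> 0%num ->
  log2 (fp_val (pow_lo a n)) <= n%:R * log2 (fp_val a).
Proof.
move=> a0 p0; rewrite -log2X ?fp_val_gt0 //; apply: log2_le; first exact: fp_val_gt0.
rewrite /fp_val expr_div_n ler_pdivlMr ?exprn_gt0 ?fp_unit_gt0 //.
rewrite mulrAC ler_pdivrMr ?fp_unit_gt0 // -!to_nat_pow -!natrM ler_nat.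
have := N.Div0.mul_div_le (a ^ N.of_nat n * P) (P ^ N.of_nat n).
by rewrite -/(pow_lo a n); lia.
Qed.

Lemma pow_lo_neq0 a n : (0 < n)%N -> pow_lo a n <> 0%num -> a <> 0%num.
Proof.
by move=> n0 + a0; apply; rewrite /pow_lo a0 N.pow_0_l ?N.mul_0_l ?N.Div0.div_0_l //; lia.
Qed.

(* Powers are taken in several rounded steps to keep the integers small. *)
Lemma log2_pow_lo_le a s : all (leq 1) s -> foldl pow_lo a s <> 0%num ->
  a <> 0%num /\
  log2 (fp_val (foldl pow_lo a s)) <= (\prod_(n <- s) n)%:R * log2 (fp_val a).
Proof.
elim: s a => [|n s IH] a /=; first by rewrite big_nil mul1r.
move=> /andP[n0 s0] /(IH _ s0) [p0 le_p]; have a0 := pow_lo_neq0 _ _ n0 p0.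
split=> //; apply: le_trans le_p _; rewrite big_cons mulnC natrM -mulrA.
by rewrite ler_wpM2l // pow_lo_le.
Qed.

Lemma log2_fp_ge p s a : all (leq 1) s ->
  (2 ^ N.of_nat p * P <= foldl pow_lo a s)%num ->
  a <> 0%num /\ p%:R <= (\prod_(n <- s) n)%:R * log2 (fp_val a).
Proof.
move=> s0 h; have pow0 : (2 ^ N.of_nat p)%num <> 0%num by apply: N.pow_nonzero.
have [|a0 le_p] := log2_pow_lo_le a s s0; first by nia.
split=> //; apply: le_trans le_p; rewrite -[p%:R]log2_exp2.
apply: log2_le; first by rewrite exprn_gt0.
by rewrite -[2 ^+ p](to_nat_pow 2) -fp_val_mul_unit; exact: fp_val_le.
Qed.

Lemma log2_fp_lt p q a : a <> 0%num ->
  (a ^ N.of_nat q < 2 ^ N.of_nat p * P ^ N.of_nat q)%num -> 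
  q%:R * log2 (fp_val a) < p%:R.
Proof.
move=> a0 h; rewrite -log2X ?fp_val_gt0 // -[p%:R]log2_exp2.
apply: log2_lt; first by rewrite exprn_gt0 ?fp_val_gt0.
rewrite /fp_val expr_div_n ltr_pdivrMr ?exprn_gt0 ?fp_unit_gt0 // -!to_nat_pow.
by rewrite -[2 ^+ p](to_nat_pow 2) -natrM ltr_nat; lia.
Qed.


Lemma harm1 : harm R (2 ^ 1 - 1) = fp_val P.
Proof. by rewrite fp_val1 /harm big_nat1 invr1. Qed.

(** Twice the limit is at least [log2 r] for the radical [r], and the check says
    [r^500 >= 2^637]. *)
Lemma lim_series_alpha_lb_of_check :
  (2 ^ N.of_nat 637 * P
     <= foldl pow_lo (nested_lo block_lo 26 0 P) [:: 5; 5; 5; 4]%N)%num ->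
  637 / 1000 <= limn (series (alpha_term R)).
Proof.
move=> /(log2_fp_ge 637 [:: 5; 5; 5; 4]%N _ isT) [r0].
have hP : fp_val P <= harm R (2 ^ 1 - 1) by rewrite harm1.
have := nested_lo_le 26 0 P hP r0; rewrite sum_log2_harm.
have -> : (\prod_(n <- [:: 5; 5; 5; 4]) n = 500)%N by rewrite unlock.
have := lim_series_alpha_ge R 26.
by move: (limn _) (series _ _) (log2 _) => b u t; lra.
Qed.

(** Twice the limit is at most [log2 r], and the check gives [log2 r < 51/40 < 2 * 638/1000]. *)
Lemma lim_series_alpha_ub_of_check :
  (nested_up block_up 9 0 P ^ N.of_nat 40 < 2 ^ N.of_nat 51 * P ^ N.of_nat 40)%num ->
  limn (series (alpha_term R)) < 638 / 1000.
Proof.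
have hP : harm R (2 ^ 1 - 1) <= fp_val P by rewrite harm1.
move=> /(log2_fp_lt 51 40 _ (nested_up_neq0 _ _ _ _)).
have := nested_up_ge 9 0 P hP; rewrite sum_log2_harm.
have := lim_series_alpha_le R 9 _ (series_alpha_tail9 R).
have := log2_80_ge R.
by move: (limn _) (series _ _) (log2 (fp_val _)) (log2 80) => b u w t; lra.
Qed.

End FixedPoint.

(** The rounding unit [2^-32], about [2.3e-10], is far below the margin of the lower bound. *)
Definition fp_unit : N := (2 ^ 32)%num.

Lemma nested_lo_check : (2 ^ N.of_nat 637 * fp_unit <=
  foldl (pow_lo fp_unit) (nested_lo fp_unit (block_lo fp_unit) 26 0 fp_unit)
    [:: 5; 5; 5; 4]%N)%num.
Proof. by vm_compute. Qed.

Lemma nested_up_check :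
  (nested_up fp_unit (block_up fp_unit) 9 0 fp_unit ^ N.of_nat 40 <
   2 ^ N.of_nat 51 * fp_unit ^ N.of_nat 40)%num.
Proof. by vm_compute. Qed.

Lemma fp_unit_neq0 : fp_unit <> 0%num.
Proof. by []. Qed.

Lemma lim_series_alpha_lb (R : realType) : 637 / 1000 <= limn (series (alpha_term R)).
Proof. exact: (lim_series_alpha_lb_of_check R fp_unit fp_unit_neq0 nested_lo_check). Qed.

Lemma lim_series_alpha_ub (R : realType) : limn (series (alpha_term R)) < 638 / 1000.
Proof. exact: (lim_series_alpha_ub_of_check R fp_unit fp_unit_neq0 nested_up_check). Qed.

Theorem lemma2p3 (R : realType) :
  (forall (k : nat) (T : tree), (0 < k)%N -> tree_size T = k ->
     ((forall T' : tree, tree_size T' = k ->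
         (DTCS R k [set T'] <= DTCS R k [set T])%E) <->
      is_ordering_of T (CBT k))) /\
  (exists eps : nat -> R,
     eps k @[k --> \oo] --> 0 /\
     (forall k : nat, (0 < k)%N ->
        DTCS R k [set CBT k] = (2 `^ (- (alpha R + eps k) * k%:R))%:E)) /\
  cvgn (series (@alpha_term R)) /\
  1637 / 1000 <= alpha R < 1638 / 1000.
Proof.
split; first exact: DTCS_maximal_iff.
split; first by exists (cbt_eps R); split; [exact: cbt_eps_cvg|exact: DTCS_CBT].
split; first exact: cvg_series_alpha.
have := lim_series_alpha_lb R; have := lim_series_alpha_ub R.
rewrite /alpha; move: (limn _) => l hu hl; apply/andP; split; lra.
Qed.
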